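(* The Max-$\lambda$ policy is optimal for the problem $$\text{maximize }\ \liminf_{T\to\infty}\frac1T\sum_{t=0}^{T-1}\sum_{n=1}^N\alpha_n(t)$$ subject to, for all $n\in\{1,\dots,N\}$ and $t\in\{0,1,2,\dots\}$: $\sum_{n=1}^N\alpha_n(t)\le M$; $\alpha_n(t)\in\{0,F_n(t)\}$; $\Pr[F_n(t+1)=1\,|\,F_n(t)=0]=\lambda_n$; $\Pr[F_n(t+1)=0\,|\,F_n(t)=1]=\alpha_n(t)(1-\lambda_n)$. In particular, under the single-buffer queue interpretation given in the context, it maximizes throughput over all policies that transmit on each slot $t$ without knowledge of the arrival vector $\mathbf A(t)$.
   Context: **Single-buffer queue interpretation.** There are $N$ queues, each with a buffer storing at most one packet, and $M$ servers ($M<N$). $F_n(t)\in\{0,1\}$ equals $1$ iff queue $n$ holds a packet at the beginning of slot $t$. On slot $t$ the policy chooses $\alpha_n(t)\in\{0,F_n(t)\}$ ($\alpha_n(t)=1$ means queue $n$ is served and transmits its packet) with $\sum_n\alpha_n(t)\le M$. At the end of slot $t$ the arrival vector $\mathbf A(t)=(A_1(t),\dots,A_N(t))\in\{0,1\}^N$ occurs; it is i.i.d. over slots with independent coordinates and $\Pr[A_n(t)=1]=\lambda_n$. An arrival to queue $n$ is accepted only if queue $n$ is empty at the end of the slot (after service), and is dropped otherwise. Thus $F_n(t+1)=1$ if $F_n(t)-\alpha_n(t)=1$, and $F_n(t+1)=A_n(t)$ otherwise. Throughput is $\liminf_{T\to\infty}\frac1T\sum_{t=0}^{T-1}\sum_n\alpha_n(t)$.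 **Max-$\lambda$ policy.** On each slot, if there are fewer than $M$ non-empty queues, serve all of them; else serve the $M$ non-empty queues with the largest values of $\lambda_n$.
   Formalization: In the general problem the transition probabilities are taken conditionally on all information available at slot t, and the N components are assumed to move independently given it, as in the queue interpretation; with only the displayed marginals the claim fails. *)

(* Defs.v *)
From HB Require Import structures.
From mathcomp Require Import all_boot all_order all_algebra.
From mathcomp Require Import all_classical all_reals all_analysis.
Set Implicit Arguments.
Unset Strict Implicit.
Unset Printing Implicit Defensive.
Import Order.TTheory GRing.Theory Num.Theory.
Local Open Scope classical_set_scope.
Local Open Scope ring_scope.

(* Both the occupancy vector (F_1(t), ..., F_N(t)) and the service vector
   (alpha_1(t), ..., alpha_N(t)) are elements of {0,1}^N. *)
Definition bitvec (N : nat) := {ffun 'I_N -> bool}.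

Section Probability.
Context {d : measure_display} {Omega : measurableType d} {R : realType}.
Variable P : probability Omega R.

Definition pr (E : set Omega) : R := fine (P E).

(* Only used below for conditioning events B with 0 < pr B. *)
Definition cond_pr (E B : set Omega) : R := pr (E `&` B) / pr B.

End Probability.

(* The information available to the controller at each slot. *)
Definition filtration {d : measure_display} {Omega : measurableType d}
    (H : nat -> set (set Omega)) : Prop :=
  [/\ forall t, sigma_algebra setT (H t),
      forall t, H t `<=` measurable
    & forall t, H t `<=` H t.+1].

Definition adapted {d : measure_display} {Omega : measurableType d} {N : nat}
    (H : nat -> set (set Omega)) (X : nat -> Omega -> bitvec N) : Prop :=
  forall t (x : bitvec N), H t [set w | X t w = x].

(* The liminf of the time averages along the sample path w. *)
Definition throughput {Omega : Type} (R : realType) {N : nat}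
    (alpha : nat -> Omega -> bitvec N) (w : Omega) : \bar R :=
  limn_einf (fun T : nat =>
    ((T%:R)^-1 * \sum_(0 <= t < T) \sum_(n < N) (alpha t w n)%:R)%:E).

Definition service_constraints {Omega : Type} {N : nat} (M : nat)
    (F alpha : nat -> Omega -> bitvec N) : Prop :=
  forall t w, (\sum_(n < N) alpha t w n <= M)%N /\
    forall n, alpha t w n \in [:: false; F t w n].

(* A process (F, alpha) feasible for the control problem.  The transition
   probabilities are conditional on the whole information H t at the decision
   epoch (G ranges over the events of H t), so that alpha t cannot anticipate
   the transition from t to t + 1; given the current occupancy f and
   decision a, the N components move independently of each other. *)
Record feasible {d : measure_display} {Omega : measurableType d} {R : realType}
    (P : probability Omega R) {N : nat} (M : nat) (lam : 'I_N -> R)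
    (H : nat -> set (set Omega)) (F alpha : nat -> Omega -> bitvec N) : Prop :=
  Feasible {
    feasible_filtration : filtration H;
    feasible_state : adapted H F;
    feasible_action : adapted H alpha;
    feasible_service : service_constraints M F alpha;
    feasible_arrival : forall t n (G : set Omega), H t G ->
      let B := G `&` [set w | F t w n = false] in
      0 < pr P B ->
      cond_pr P [set w | F t.+1 w n = true] B = lam n;
    feasible_departure : forall t n (a : bool) (G : set Omega), H t G ->
      let B := G `&` [set w | F t w n = true]
                 `&` [set w | alpha t w n = a] in
      0 < pr P B ->
      cond_pr P [set w | F t.+1 w n = false] B = a%:R * (1 - lam n);
    feasible_indep : forall t (f a g : bitvec N) (G : set Omega), H t G ->
      let B := G `&` [set w | F t w = f] `&` [set w | alpha t w = a] in
      0 < pr P B ->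
      cond_pr P [set w | F t.+1 w = g] B =
        \prod_(n < N) cond_pr P [set w | F t.+1 w n = g n] B }.

(* Arrival vectors that are i.i.d. over slots, with independent coordinates:
   the family of all A t . n is mutually independent and A t . n is
   Bernoulli with parameter lam n. *)
Record iid_arrivals {d : measure_display} {Omega : measurableType d}
    {R : realType} (P : probability Omega R) {N : nat} (lam : 'I_N -> R)
    (A : nat -> Omega -> bitvec N) : Prop :=
  IidArrivals {
    arrivals_measurable : forall t (b : bitvec N),
      measurable [set w | A t w = b];
    arrivals_rate : forall t n, pr P [set w | A t w n = true] = lam n;
    arrivals_indep : forall (T : nat) (b : nat -> bitvec N),
      pr P [set w | forall t, (t < T)%N -> A t w = b t] =
        \prod_(0 <= t < T) \prod_(n < N) pr P [set w | A t w n = b t n] }.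

(* The single-buffer queues fed by A, under a policy that uses at slot t the
   information H t, which is independent of A t. *)
Record queue_policy {d : measure_display} {Omega : measurableType d}
    {R : realType} (P : probability Omega R) {N : nat} (M : nat)
    (A : nat -> Omega -> bitvec N)
    (H : nat -> set (set Omega)) (F alpha : nat -> Omega -> bitvec N) : Prop :=
  QueuePolicy {
    queue_filtration : filtration H;
    queue_state : adapted H F;
    queue_action : adapted H alpha;
    queue_service : service_constraints M F alpha;
    queue_blind : forall t (b : bitvec N) (G : set Omega), H t G ->
      pr P (G `&` [set w | A t w = b]) = pr P G * pr P [set w | A t w = b];
    queue_dynamics : forall t w n,
      F t.+1 w n = if F t w n && ~~ alpha t w n then true else A t w n }.

(* Ties between equal values of lam may be broken arbitrarily. *)
Definition max_lambda_action {R : realType} {N : nat} (M : nat)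
    (lam : 'I_N -> R) (f a : bitvec N) : Prop :=
  if (#|[set n | f n]%SET| < M)%N then a = f
  else [/\ #|[set n | a n]%SET| = M,
           forall n, a n -> f n
         & forall i j, a i -> f j -> ~~ a j -> lam j <= lam i].

Definition max_lambda_policy {Omega : Type} {R : realType} {N : nat} (M : nat)
    (lam : 'I_N -> R) (F alpha : nat -> Omega -> bitvec N) : Prop :=
  forall t w, max_lambda_action M lam (F t w) (alpha t w).

(* Main.v *)
(* The post-service state [S] evolves to the union of [S] with the set of
   arrivals, so the problem is a finite Markov decision process.  By induction
   on the horizon, its value function [V] is nondecreasing, grows by at most 1
   per added packet, and prefers a packet at a queue with a smaller arrival rate
   to a packet at a queue with a larger one; hence serving the packets with the
   largest [lam] attains the maximum at every horizon, however ties are broken.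
   Limits of Cesaro means of [V] give a solution [(phi, h)] of the average
   reward optimality equation, with equality along Max-lambda actions.  For any
   admissible policy the rewards compensated by [h] and [phi] thus form a
   supermartingale with bounded increments (a martingale for Max-lambda), and an
   exponential moment bound with the Borel-Cantelli lemma shows that the time
   averages are eventually at most [phi] up to any error (resp. tend to [phi]).
   The queueing model and the conditional-probability constraints induce the same
   transition kernel. *)

Require Import Defs.
From HB Require Import structures.
From mathcomp Require Import all_boot all_order all_algebra.
From mathcomp Require Import all_classical all_reals all_analysis.
From mathcomp Require Import ring lra.
Set Implicit Arguments.
Unset Strict Implicit.
Unset Printing Implicit Defensive.
Import Order.TTheory GRing.Theory Num.Theory.
Local Open Scope classical_set_scope.
Local Open Scope ring_scope.

(** * Finite-horizon optimality of the greedy action *)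

Section Arrivals.
Import mathcomp.boot.fintype mathcomp.boot.finset.
Local Open Scope set_scope.
Local Open Scope ring_scope.
Context {R : realType} {N : nat} {lam : 'I_N -> R}.
Implicit Types (B f : {set 'I_N}) (phi psi : {set 'I_N} -> R).

Definition arrival_weight (lam : 'I_N -> R) B : R :=
  \prod_n (if n \in B then lam n else 1 - lam n).

Definition arrival_mean (lam : 'I_N -> R) phi : R :=
  \sum_B arrival_weight lam B * phi B.

Lemma sum_arrival_weight : \sum_B arrival_weight lam B = 1.
Proof.
transitivity (\prod_n (lam n + (1 - lam n))); first by rewrite bigA_distr.
by apply: big1 => n _; rewrite addrC subrK.
Qed.

Lemma arrival_mean_cst c : arrival_mean lam (fun=> c) = c.
Proof. by rewrite /arrival_mean -mulr_suml sum_arrival_weight mul1r. Qed.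

Lemma arrival_meanDr phi c :
  arrival_mean lam (fun B => phi B + c) = arrival_mean lam phi + c.
Proof.
rewrite -[c in RHS]arrival_mean_cst -big_split.
by apply: eq_bigr => B _; rewrite mulrDr.
Qed.

(** The arrival sets pair off as [B] and [i |: B] with [i] outside [B], and the weights of a pair
    differ only in the factor at [i]. *)
Lemma arrival_mean_split i phi :
  arrival_mean lam phi =
  \sum_(B : {set 'I_N} | i \notin B)
    (\prod_(n | n != i) (if n \in B then lam n else 1 - lam n)) *
    ((1 - lam i) * phi B + lam i * phi (i |: B)).
Proof.
rewrite /arrival_mean (bigID (fun B => i \in B)) /= addrC.
rewrite [X in _ + X](reindex_onto (fun B => i |: B) (fun B => B :\ i)) /=; last first.
  by move=> B iB; rewrite setD1K.
rewrite [X in _ + X](eq_bigl (fun B : {set 'I_N} => i \notin B)); last first.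
  move=> B; rewrite setU11 /=; apply/eqP/idP => [<-|iB]; first by rewrite setD11.
  by rewrite setU1K.
rewrite -big_split /=; apply: eq_bigr => B iB.
rewrite /arrival_weight (bigD1 i) //= (negPf iB).
rewrite [X in _ + X * _](bigD1 i) //= setU11.
rewrite [X in _ + _ * X * _](eq_bigr (fun n => if n \in B then lam n else 1 - lam n));
  last by move=> n ni; rewrite in_setU1 (negPf ni).
ring.
Qed.

(** Redrawing the arrival at [i] independently leaves the law of the arrival set unchanged. This
    exposes the arrival at a chosen queue under the mean, so that two means can be compared term by
    term. *)
Lemma arrival_mean_resample i phi :
  arrival_mean lam phi =
  arrival_mean lam (fun B => (1 - lam i) * phi (B :\ i) + lam i * phi (i |: B)).
Proof.
rewrite (arrival_mean_split i phi).
rewrite (arrival_mean_split i (fun B => _ * phi (B :\ i) + _)).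
apply: eq_bigr => B iB; rewrite setU1K // setUA setUid.
have -> : B :\ i = B by apply/setDidPl; rewrite disjoint_sym disjoints1.
by congr (_ * _); ring.
Qed.

Lemma arrival_mean_sum (I : Type) (s : seq I) (c : I -> R)
    (phi : I -> {set 'I_N} -> R) :
  arrival_mean lam (fun B => \sum_(k <- s) c k * phi k B) =
  \sum_(k <- s) c k * arrival_mean lam (phi k).
Proof.
rewrite /arrival_mean; under eq_bigr do rewrite mulr_sumr.
rewrite exchange_big /=; apply: eq_bigr => k _; rewrite mulr_sumr.
by apply: eq_bigr => B _; rewrite mulrCA.
Qed.

Hypothesis lam01 : forall n, 0 <= lam n <= 1.

Lemma arrival_weight_ge0 B : 0 <= arrival_weight lam B.
Proof.
apply: prodr_ge0 => n _; have /andP[l0 l1] := lam01 n.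
by case: ifP => // _; rewrite subr_ge0.
Qed.

Lemma le_arrival_mean phi psi : (forall B, phi B <= psi B) ->
  arrival_mean lam phi <= arrival_mean lam psi.
Proof.
by move=> le; apply: ler_sum => B _; rewrite ler_wpM2l ?arrival_weight_ge0.
Qed.

End Arrivals.

(** * The Bellman operator, value iteration and the exchange argument *)

Section Bellman.
Import mathcomp.boot.fintype mathcomp.boot.finset.
Local Open Scope set_scope.
Local Open Scope ring_scope.
Context {R : realType} {N : nat} (M : nat) (lam : 'I_N -> R).
Hypothesis lam01 : forall n, 0 <= lam n <= 1.
Implicit Types (a b f r B : {set 'I_N}) (h : {set 'I_N} -> R) (i j : 'I_N).

Definition next_value h r : R := arrival_mean lam (fun B => h (r :|: B)).

(** The default 0 of the maximum does not bind for nonnegative [h]: the empty action is always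
    allowed and has a nonnegative value. *)
Definition step_value h f : R :=
  \big[Num.max/0]_(a : {set 'I_N} | (a \subset f) && (#|a| <= M)%N)
    (#|a|%:R + next_value h (f :\: a)).

Fixpoint horizon_value (k : nat) : {set 'I_N} -> R :=
  if k is k'.+1 then step_value (horizon_value k') else fun=> 0.

(* The last clause compares two states with equally many packets: the packet
   at the more slowly refilled queue is the more valuable one. *)
Definition ordered_value h : Prop :=
  [/\ forall f, 0 <= h f, forall f i, h f <= h (i |: f),
      forall f i, h (i |: f) <= h f + 1
    & forall f i j, i \notin f -> j \notin f -> lam j <= lam i ->
        h (i |: f) <= h (j |: f)].

Lemma step_value_ge0 h f : 0 <= step_value h f.
Proof. exact: bigmax_ge_id. Qed.

Lemma le_step_value h f a : a \subset f -> (#|a| <= M)%N ->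
  #|a|%:R + next_value h (f :\: a) <= step_value h f.
Proof.
move=> af aM; pose F a := #|a|%:R + next_value h (f :\: a).
by apply: (le_bigmax_cond 0 F); rewrite af aM.
Qed.

Lemma step_value_le h f x : 0 <= x ->
  (forall a, a \subset f -> (#|a| <= M)%N ->
    #|a|%:R + next_value h (f :\: a) <= x) ->
  step_value h f <= x.
Proof. by move=> x0 le; apply: bigmax_le => // a /andP[]; exact: le. Qed.

Section OrderedValue.
Context {h : {set 'I_N} -> R}.
Hypothesis ord_h : ordered_value h.

Lemma next_value_mono r i : next_value h r <= next_value h (i |: r).
Proof.
have [_ mono _ _] := ord_h.
by apply: (le_arrival_mean lam01) => B; rewrite -setUA.
Qed.

Lemma next_value_lip r i : next_value h (i |: r) <= next_value h r + 1.
Proof.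
have [_ _ lip _] := ord_h; rewrite /next_value -arrival_meanDr.
by apply: (le_arrival_mean lam01) => B; rewrite -setUA.
Qed.

(** Redraw the arrivals at [i] and [j] over a common background [T]. The left state ends in [i |: T]
    with probability [1 - lam j], the right one in [j |: T] with probability [1 - lam i], and
    otherwise both end in [j |: (i |: T)]. *)
Lemma next_value_exch r i j : i \notin r -> j \notin r -> lam j <= lam i ->
  next_value h (i |: r) <= next_value h (j |: r).
Proof.
move=> ir jr lij; have [->//|neq_ij] := eqVneq i j.
have [_ mono _ exch] := ord_h.
rewrite /next_value (arrival_mean_resample i) (arrival_mean_resample j).
rewrite [leRHS](arrival_mean_resample i) [leRHS](arrival_mean_resample j).
apply: (le_arrival_mean lam01) => B.
pose T := r :|: (B :\ i :\ j).
have iT : i \notin T by rewrite !inE (negPf ir) eqxx andbF.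
have jT : j \notin T by rewrite !inE (negPf jr) eqxx.
have ji : (j == i) = false by rewrite eq_sym (negPf neq_ij).
have /andP[_ li1] := lam01 i.
have hij := exch T i j iT jT lij.
have hi : h (i |: T) <= h (j |: (i |: T)) by exact: mono.
have -> : i |: r :|: B :\ j :\ i = i |: T.
  by apply/setP => x; rewrite !inE; case: (x == i); case: (x == j); case: (x \in r).
have -> : i |: r :|: (i |: B :\ j) = i |: T.
  by apply/setP => x; rewrite !inE; case: (x == i); case: (x == j); case: (x \in r).
have -> : i |: r :|: (j |: B) :\ i = j |: (i |: T).
  apply/setP => x; rewrite !inE.
  by case: (x == i); case: (x == j); case: (x \in r); case: (x \in B).
have -> : i |: r :|: (i |: (j |: B)) = j |: (i |: T).
  apply/setP => x; rewrite !inE.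
  by case: (x == i); case: (x == j); case: (x \in r); case: (x \in B).
have -> : j |: r :|: B :\ j :\ i = j |: T.
  by apply/setP => x; rewrite !inE; case: (x == i); case: (x == j); case: (x \in r).
have -> : j |: r :|: (i |: B :\ j) = j |: (i |: T).
  apply/setP => x; rewrite !inE.
  by case: (x == i); case: (x == j); case: (x \in r); case: (x \in B).
have -> : j |: r :|: (j |: B) :\ i = j |: T.
  apply/setP => x; rewrite !inE; have [->|] := eqVneq x i.
    by rewrite (negPf neq_ij) (negPf ir).
  by case: (x == j); case: (x \in r); case: (x \in B).
have -> : j |: r :|: (i |: (j |: B)) = j |: (i |: T).
  apply/setP => x; rewrite !inE.
  by case: (x == i); case: (x == j); case: (x \in r); case: (x \in B).
(* The right side minus the left is [(1 - lam i) * (h (j |: T) - h (i |: T)) + (lam i - lam j) * (h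
   (j |: (i |: T)) - h (i |: T))], a sum of nonnegative terms. *)
nra.
Qed.

(** Each clause matches an action [a] on the left with one on the right. If [i] is served, drop it
    at the loss of one packet, or serve [j] in its place; the post-service state stays the same.
    Otherwise keep [a] and use the corresponding property of [next_value]. *)
Lemma ordered_step_value : ordered_value (step_value h).
Proof.
split; first exact: step_value_ge0.
- move=> f i; have [iF|iF] := boolP (i \in f); first by rewrite (setUidPr _) ?sub1set.
  apply: step_value_le; first exact: step_value_ge0.
  move=> a af aM; have ia : i \notin a by apply: contra iF; exact: (subsetP af).
  have := le_step_value h (subset_trans af (subsetU1 i f)) aM.
  apply: le_trans; rewrite lerD2l setDUl.
  have -> : [set i] :\: a = [set i] by apply/setDidPl; rewrite disjoints1.
  exact: next_value_mono.
- move=> f i; have [iF|iF] := boolP (i \in f).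
    by rewrite (setUidPr _) ?sub1set // lerDl.
  apply: step_value_le => [|a]; first by rewrite addr_ge0 ?step_value_ge0.
  have [ia|ia] := boolP (i \in a) => af aM.
    have af' : a :\ i \subset f by rewrite subDset.
    have aM' : (#|a :\ i| <= M)%N.
      by apply: leq_trans aM; exact: subset_leq_card (subD1set _ _).
    have := le_step_value h af' aM'.
    have -> : f :\: (a :\ i) = (i |: f) :\: a.
      apply/setP => x; rewrite !inE.
      by have [->|//] := eqVneq x i; rewrite ia (negPf iF).
    by rewrite (cardsD1 i a) ia natrD /=; lra.
  have af' : a \subset f.
    apply/subsetP => x xa; have := subsetP af x xa.
    by rewrite in_setU1 => /orP[/eqP xi|//]; rewrite -xi xa in ia.
  have := le_step_value h af' aM; have := next_value_lip (f :\: a) i.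
  have -> : (i |: f) :\: a = i |: f :\: a.
    by apply/setP => x; rewrite !inE; have [->|] := eqVneq x i; rewrite ?ia.
  lra.
- move=> f i j iF jF lij; have [->//|neq_ij] := eqVneq i j.
  apply: step_value_le => [|a af aM]; first exact: step_value_ge0.
  have ja : j \notin a.
    by apply: contra jF => /(subsetP af); rewrite in_setU1 eq_sym (negPf neq_ij).
  have [ia|ia] := boolP (i \in a).
    have jai : j \notin a :\ i by rewrite !inE (negPf ja) andbF.
    have eqc : #|j |: a :\ i| = #|a| by rewrite cardsU1 jai [RHS](cardsD1 i) ia.
    have af' : j |: a :\ i \subset j |: f by rewrite setUS // subDset.
    have aM' : (#|(j |: a :\ i)%SET| <= M)%N by rewrite eqc.
    have := le_step_value h af' aM'; rewrite eqc.
    suff -> : (j |: f) :\: (j |: a :\ i) = (i |: f) :\: a by [].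
    apply/setP => x; rewrite !inE.
    have [->|xi] := eqVneq x i; first by rewrite (negPf neq_ij) (negPf iF) ia.
    by have [->|xj] := eqVneq x j; rewrite ?(negPf jF) ?andbF.
  have af' : a \subset j |: f.
    apply/subsetP => x xa; have := subsetP af x xa; rewrite !in_setU1 => /orP[/eqP xi|->].
      by rewrite -xi xa in ia.
    by rewrite orbT.
  have := le_step_value h af' aM; apply: le_trans; rewrite lerD2l.
  have -> : (i |: f) :\: a = i |: f :\: a.
    by apply/setP => x; rewrite !inE; have [->|] := eqVneq x i; rewrite ?ia.
  have -> : (j |: f) :\: a = j |: f :\: a.
    by apply/setP => x; rewrite !inE; have [->|] := eqVneq x j; rewrite ?ja.
  by apply: next_value_exch => //; rewrite inE (negPf iF, negPf jF) andbF.
Qed.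

(* Any feasible action is turned into the greedy one by serving one more packet
   or by exchanging a served packet for one that refills faster; neither move
   decreases the value. *)
Lemma greedy_step_value f b : b \subset f -> (#|b| <= M)%N ->
  ((#|b| < M)%N -> b = f) ->
  (forall i j, i \in b -> j \in f -> j \notin b -> lam j <= lam i) ->
  step_value h f = #|b|%:R + next_value h (f :\: b).
Proof.
move=> bf bM b_all b_greedy; apply/eqP; rewrite eq_le le_step_value // andbT.
apply: step_value_le => [|a af aM].
  by rewrite addr_ge0 //; have [h0 _ _ _] := ord_h; apply: sumr_ge0 => B _;
     rewrite mulr_ge0 ?arrival_weight_ge0.
(* Induction on the number of packets served by [b] but not by [a]. A feasible [a] containing [b]
   equals [b], which is all of [f] or already has [M] elements. *)
have [m] := ubnP #|b :\: a|; elim: m a af aM => // m IH a af aM.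
have [ba _|/subsetPn[i ib ia]] := boolP (b \subset a).
  suff -> : a = b by [].
  apply/eqP; rewrite eq_sym eqEcard ba /=.
  have [/b_all ->|Mb] := ltnP #|b| M; first exact: subset_leq_card.
  exact: leq_trans aM Mb.
have iF := subsetP bf i ib.
have rest_i : f :\: a = i |: f :\: (i |: a).
  apply/setP => x; rewrite !inE; have [->|] := eqVneq x i; first by rewrite iF ia.
  by [].
have ba_i : (#|b :\: (i |: a)| < #|b :\: a|)%N.
  apply: proper_card; apply/properP; split; first by rewrite setDS ?subsetU1.
  by exists i; rewrite !inE ?ia ?ib ?eqxx.
rewrite ltnS => cb; have [a_lt|a_ge] := ltnP #|a| M.
  have af' : i |: a \subset f by rewrite subUset sub1set iF.
  have aM' : (#|(i |: a)%SET| <= M)%N by rewrite cardsU1 ia.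
  have := IH _ af' aM' (leq_trans ba_i cb).
  apply: le_trans; rewrite cardsU1 ia natrD rest_i /=.
  by have := next_value_lip (f :\: (i |: a)) i; lra.
(* Without spare capacity, [a] has at least as many elements as [b] but misses [i], so it serves
   some [j] outside [b]. *)
have [j ja jb] : exists2 j, j \in a & j \notin b.
  apply/subsetPn; apply/negP => ab; have := leq_trans bM a_ge.
  rewrite leqNgt => /negP; apply; apply: proper_card; apply/properP.
  by split => //; exists i.
have jF := subsetP af j ja.
have neq_ij : i != j by apply: contraNneq jb => <-.
have iaj : i \notin a :\ j by rewrite !inE (negPf ia) andbF.
have eqc : #|i |: a :\ j| = #|a| by rewrite cardsU1 iaj [RHS](cardsD1 j) ja.
have af' : i |: a :\ j \subset f.
  by rewrite subUset sub1set iF (subset_trans (subD1set _ _)).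
have aM' : (#|(i |: a :\ j)%SET| <= M)%N by rewrite eqc.
have ba_ij : b :\: (i |: a :\ j) = b :\: (i |: a).
  apply/setP => x; rewrite !inE; have [->|//] := eqVneq x j.
  by rewrite (negPf jb) !andbF.
have := IH _ af' aM'; rewrite ba_ij eqc => /(_ (leq_trans ba_i cb)).
apply: le_trans; rewrite lerD2l rest_i.
have -> : f :\: (i |: a :\ j) = j |: f :\: (i |: a).
  apply/setP => x; rewrite !inE.
  by have [->|xj] := eqVneq x j; rewrite ?(eq_sym j) ?(negPf neq_ij) ?jF ?ja.
apply: next_value_exch; rewrite ?inE ?eqxx ?ja ?orbT //.
exact: b_greedy.
Qed.

End OrderedValue.

Lemma ordered_horizon_value k : ordered_value (horizon_value k).
Proof.
elim: k => [|k]; last exact: ordered_step_value.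
by split=> // f i; rewrite ?addr_ge0.
Qed.

(** Packets are removed one at a time, by monotonicity and the unit increment bound. The spread is
    bounded uniformly in [k], as the later compactness argument requires. *)
Lemma horizon_value_bounds k f :
  horizon_value k set0 <= horizon_value k f <= horizon_value k set0 + #|f|%:R.
Proof.
have [_ mono lip _] := ordered_horizon_value k.
have [m] := ubnP #|f|; elim: m f => // m IH f.
have [->|[i iF]] := set_0Vmem f; first by rewrite cards0 addr0 lexx.
rewrite (cardsD1 i) iF ltnS add1n => /IH /andP[lo hi].
have := mono (f :\ i) i; have := lip (f :\ i) i; rewrite setD1K // -natr1.
by move=> ? ?; apply/andP; split; lra.
Qed.
End Bellman.

(** * The average reward optimality equation *)

Section Limits.
Import numFieldNormedType.Exports.

Lemma increasing_seq_cvg (f : nat -> nat) :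
  increasing_seq f -> f @ \oo --> \oo.
Proof.
move=> f_inc; have f_ge n : (n <= f n)%N.
  elim: n => // n IH; apply: leq_ltn_trans IH _.
  by have := f_inc n.+1 n; rewrite ltnn leEnat => /negbT; rewrite -ltnNge.
by apply/cvgnyPge => A; near do apply: leq_trans (f_ge _); exact: nbhs_infty_ge.
Unshelve. all: by end_near. Qed.

(** Subsequences are extracted one index at a time; each further extraction keeps the limits already
    obtained. *)
Lemma finite_bolzano_weierstrass (R : realType) (I : finType) (C : R)
    (u : I -> nat -> R) : (forall i n, `|u i n| <= C) ->
  exists2 f : nat -> nat, increasing_seq f & forall i, cvgn (u i \o f).
Proof.
move=> uC; suff [f f_inc fs] : exists2 f : nat -> nat, increasing_seq f &
    forall i, i \in enum I -> cvgn (u i \o f).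
  by exists f => // i; apply: fs; rewrite mem_enum.
elim: (enum I) => [|i s [f f_inc fs]]; first by exists id.
have [|g g_inc gi] := @bolzano_weierstrass R (u i \o f).
  exists C; split=> [|x Cx n _ /=]; first exact: num_real.
  exact: le_trans (uC _ _) (ltW Cx).
exists (f \o g) => [m n|j]; first exact: etrans (f_inc _ _) (g_inc _ _).
rewrite in_cons => /orP[/eqP-> //|/fs/cvg_ex[l ul]].
by apply/cvg_ex; exists l; apply: cvg_comp (increasing_seq_cvg g_inc) ul.
Qed.

End Limits.

Section AverageOptimality.
Import numFieldNormedType.Exports.
Import mathcomp.boot.fintype mathcomp.boot.finset.
Local Open Scope set_scope.
Local Open Scope ring_scope.
Context {R : realType} {N : nat} (M : nat) (lam : 'I_N -> R).
Hypothesis lam01 : forall n, 0 <= lam n <= 1.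
Implicit Types (a b f : {set 'I_N}) (h : {set 'I_N} -> R).

Lemma cvg_next_value (u : {set 'I_N} -> nat -> R) h f :
  (forall g, u g n @[n --> \oo] --> h g) ->
  next_value lam (u ^~ n) f @[n --> \oo] --> next_value lam h f.
Proof.
move=> uh; apply: (cvg_big (P := xpredT) add_continuous) => B _.
by apply: cvgM; [exact: cvg_cst|exact: uh].
Qed.

Local Notation V := (horizon_value M lam).

Lemma horizon_value_le k f : V k f <= (M * k)%:R.
Proof.
elim: k f => [|k IH] f; first by rewrite muln0.
apply: step_value_le => // a _ aM.
rewrite mulnS natrD lerD ?ler_nat // -[leRHS](@arrival_mean_cst R N lam).
exact: le_arrival_mean.
Qed.

(* [h] and [phi] are limits, along a subsequence, of the Cesaro means of
   [V k f - V k set0] and of the increments [V k.+1 set0 - V k set0]. *)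
Lemma average_optimality_equation :
  exists phi h,
    (forall f a, a \subset f -> (#|a| <= M)%N ->
       #|a|%:R + next_value lam h (f :\: a) <= phi + h f) /\
    (forall f b, b \subset f -> (#|b| <= M)%N ->
       ((#|b| < M)%N -> b = f) ->
       (forall i j, i \in b -> j \in f -> j \notin b -> lam j <= lam i) ->
       #|b|%:R + next_value lam h (f :\: b) = phi + h f).
Proof.
pose G f (n : nat) : R := \sum_(0 <= k < n.+1) n.+1%:R^-1 * (V k f - V k set0).
(* [p] is the mean of the increments at [set0], telescoped from horizon 0, where the value is 0.
   [e f] is the correction for telescoping at [f] instead; it is at most [N / n.+1]. *)
pose p (n : nat) : R := n.+1%:R^-1 * V n.+1 set0.
pose e f (n : nat) : R := n.+1%:R^-1 * (V n.+1 f - V n.+1 set0).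
pose C : R := M%:R + N%:R.
have Vb k f : 0 <= V k f - V k set0 <= N%:R.
  have /andP[lo hi] := horizon_value_bounds M lam01 k f.
  have : (#|f| <= N)%N by rewrite -[leqRHS]card_ord max_card.
  by rewrite -(ler_nat R) => fN; apply/andP; split; lra.
have n1_gt0 n : 0 < n.+1%:R^-1 :> R by rewrite invr_gt0.
have Gb f n : `|G f n| <= C.
  rewrite ger0_norm; last first.
    by apply: sumr_ge0 => k _; have /andP[V0 _] := Vb k f; rewrite mulr_ge0.
  apply: (@le_trans _ _ (\sum_(0 <= k < n.+1) n.+1%:R^-1 * N%:R)).
    by apply: ler_sum => k _; rewrite ler_pM2l //; have /andP[] := Vb k f.
  rewrite sumr_const_nat subn0 -mulrnAl -(mulr_natl n.+1%:R^-1) divff ?pnatr_eq0 //.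
  by rewrite mul1r lerDr.
have pb n : `|p n| <= C.
  have [V0 _ _ _] := ordered_horizon_value M lam01 n.+1.
  rewrite ger0_norm ?mulr_ge0 // ler_pdivrMl // (le_trans (horizon_value_le _ _)) //.
  by rewrite mulnC natrM ler_pM2l // lerDl.
(* The index [None] stands for [p], so that a single subsequence serves [p] and all the [G f]. *)
pose u (o : option {set 'I_N}) n := if o is Some f then G f n else p n.
have [|s s_inc u_cvg] := @finite_bolzano_weierstrass R _ C u.
  by case=> [f|] n; [exact: Gb|exact: pb].
pose phi := limn (p \o s); pose h f := limn (G f \o s).
have p_phi : p (s n) @[n --> \oo] --> phi by exact: u_cvg None.
have G_h f : G f (s n) @[n --> \oo] --> h f by exact: u_cvg (Some f).
have e_0 f : e f (s n) @[n --> \oo] --> 0.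
  have e0 : e f n @[n --> \oo] --> (0 : R).
    apply: (@squeeze_cvgr _ _ _ _ (fun=> 0) (fun n => N%:R * harmonic n)).
    - apply: nearW => n; have /andP[lo hi] := Vb n.+1 f.
      rewrite mulr_ge0 //= [leRHS]mulrC.
      by apply: ler_pM.
    - exact: cvg_cst.
    - by rewrite -[X in _ --> X](mulr0 N%:R); apply: cvgMl_tmp; exact: cvg_harmonic.
  exact: cvg_comp (increasing_seq_cvg s_inc) e0.
(* [gap f a n] is the mean over [k <= n] of the Bellman defects of [a], which are nonnegative for
   every feasible action and zero for a greedy one. Its limit yields both halves of the claim. *)
pose gap f a n := p n + G f n + e f n - (#|a|%:R + next_value lam (G ^~ n) (f :\: a)).
have gapE f a n : gap f a n = \sum_(0 <= k < n.+1) n.+1%:R^-1 *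
    (V k.+1 f - (#|a|%:R + next_value lam (V k) (f :\: a))).
  rewrite /gap; have -> : next_value lam (G ^~ n) (f :\: a) = \sum_(0 <= k < n.+1)
      n.+1%:R^-1 * (next_value lam (V k) (f :\: a) - V k set0).
    rewrite /next_value /G arrival_mean_sum; apply: eq_bigr => k _.
    by rewrite arrival_meanDr.
  have n1 : n.+1%:R != 0 :> R by rewrite pnatr_eq0.
  have tele : V n.+1 f = \sum_(0 <= k < n.+1) (V k.+1 f - V k f).
    by rewrite (telescope_sumr (V ^~ f)) //= subr0.
  have card_sum : #|a|%:R = \sum_(0 <= k < n.+1) n.+1%:R^-1 * #|a|%:R :> R.
    by rewrite sumr_const_nat subn0 -mulrnAl -(mulr_natl n.+1%:R^-1) divff // mul1r.
  rewrite /p /e {1}card_sum /G mulrBr tele mulr_sumr.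
  transitivity (\sum_(0 <= k < n.+1) n.+1%:R^-1 * (V k f - V k set0) +
     \sum_(0 <= k < n.+1) n.+1%:R^-1 * (V k.+1 f - V k f) -
     (\sum_(0 <= k < n.+1) n.+1%:R^-1 * #|a|%:R + \sum_(0 <= k < n.+1)
      n.+1%:R^-1 * (next_value lam (V k) (f :\: a) - V k set0))); first by ring.
  by rewrite -!big_split /= -sumrB; apply: eq_bigr => k _; ring.
have gap_cvg f a : gap f a (s n) @[n --> \oo] -->
    phi + h f - (#|a|%:R + next_value lam h (f :\: a)).
  rewrite -[phi + h f]addr0; apply: cvgB.
    by apply: cvgD; [exact: cvgD|exact: e_0].
  by apply: cvgD; [exact: cvg_cst|exact: (cvg_next_value (u := fun f n => G f (s n)))].
exists phi, h; split=> [f a af aM|f b bf bM b_all b_greedy].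
  rewrite -subr_ge0 -(cvg_lim (@Rhausdorff _) (gap_cvg f a)).
  apply: limr_ge; first by apply/cvg_ex; eexists; exact: gap_cvg.
  apply: nearW => n; rewrite gapE; apply: sumr_ge0 => k _.
  by rewrite mulr_ge0 ?(ltW (n1_gt0 _)) // subr_ge0 le_step_value.
apply/esym/eqP; rewrite -subr_eq0; apply/eqP.
rewrite -(cvg_lim (@Rhausdorff _) (gap_cvg f b)).
have -> : (fun n => gap f b (s n)) = cst 0.
  apply/funext => n; rewrite gapE big1 // => k _.
  have ordV := ordered_horizon_value M lam01 k.
  by rewrite /= (greedy_step_value lam01 ordV bf bM b_all b_greedy) subrr mulr0.
exact: lim_cst.
Qed.

End AverageOptimality.

(** * The transition kernel of the queues *)
Section QueueKernel.
Context {R : realType} {N : nat} (M : nat) (lam : 'I_N -> R).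
Hypothesis lam01 : forall n, 0 <= lam n <= 1.
Implicit Types (f a b g : bitvec N).

Definition next_state f a b : bitvec N := [ffun n => f n && ~~ a n || b n].

Definition bit_weight n (c : bool) : R := if c then lam n else 1 - lam n.

Definition queue_kernel f a g : R :=
  \sum_(b : bitvec N | next_state f a b == g) \prod_n bit_weight n (b n).

Lemma queue_kernel_ge0 f a g : 0 <= queue_kernel f a g.
Proof.
apply: sumr_ge0 => b _; apply: prodr_ge0 => n _; have /andP[l0 l1] := lam01 n.
by rewrite /bit_weight; case: (b n); rewrite // subr_ge0.
Qed.

Lemma sum_queue_kernel f a (h : bitvec N -> R) :
  \sum_g queue_kernel f a g * h g =
  \sum_(b : bitvec N) (\prod_n bit_weight n (b n)) * h (next_state f a b).
Proof.
rewrite [RHS](partition_big (next_state f a) xpredT) //=; apply: eq_bigr => g _.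
by rewrite mulr_suml; apply: eq_bigr => b /eqP->.
Qed.

Lemma sum_bit_weight : \sum_(b : bitvec N) \prod_n bit_weight n (b n) = 1.
Proof.
rewrite -(bigA_distr_bigA bit_weight) big1 // => n _.
by rewrite big_bool /bit_weight /= addrC subrK.
Qed.

Lemma sum_queue_kernel1 f a : \sum_g queue_kernel f a g = 1.
Proof.
under eq_bigr do rewrite -[queue_kernel _ _ _]mulr1.
rewrite (sum_queue_kernel f a (fun=> 1)); under eq_bigr do rewrite mulr1.
exact: sum_bit_weight.
Qed.

(** The condition [next_state f a b = g] is coordinatewise, so the sum over [b] distributes over the
    product. An occupied queue that is not served surely keeps its packet, whence the factor
    [(g n)%:R]. *)
Lemma queue_kernel_prod f a g : queue_kernel f a g =
  \prod_n (if f n && ~~ a n then (g n)%:R else bit_weight n (g n)).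
Proof.
transitivity (\prod_n \sum_(c : bool | f n && ~~ a n || c == g n) bit_weight n c).
  rewrite bigA_distr_big_dep; apply: eq_bigl => b.
  apply/eqP/familyP => [<- n|bg]; first by rewrite unfold_in ffunE.
  by apply/ffunP => n; rewrite ffunE; have := bg n; rewrite unfold_in => /eqP.
apply: eq_bigr => n _; rewrite big_mkcond big_bool /bit_weight /=.
by case: (f n && ~~ a n); case: (g n); rewrite /= ?addr0 ?add0r // addrC subrK.
Qed.

Definition bit_set f : {set 'I_N} := [set n | f n]%SET.

Lemma sum_bits a : (\sum_n a n)%N = #|bit_set a|.
Proof.
rewrite -sum1_card [RHS]big_mkcond /=; apply: eq_bigr => n _.
by rewrite inE; case: (a n).
Qed.

Lemma next_value_bit_set (h : {set 'I_N} -> R) f a :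
  next_value lam h (bit_set f :\: bit_set a)%SET =
  \sum_g queue_kernel f a g * h (bit_set g).
Proof.
rewrite sum_queue_kernel /next_value /arrival_mean.
rewrite (reindex_onto bit_set (fun B : {set 'I_N} => [ffun n => n \in B])) /=; last first.
  by move=> B _; apply/setP => n; rewrite inE ffunE.
apply: eq_big => [b|b _]; first by apply/eqP/ffunP => n; rewrite ffunE inE.
congr (_ * h _).
  by apply: eq_bigr => n _; rewrite inE.
by apply/setP => n; rewrite !inE ffunE andbC.
Qed.

(** Transports the optimality equation from sets to bit vectors. A Max-lambda action serves
    everything or exactly [M] packets, and meets the greedy conditions in both cases. *)
Lemma queue_average_optimality : exists (phi : R) (h : bitvec N -> R),
  (forall f a, (forall n, a n -> f n) -> (\sum_n a n <= M)%N ->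
     \sum_n (a n)%:R + \sum_g queue_kernel f a g * h g <= phi + h f) /\
  (forall f a, max_lambda_action M lam f a ->
     \sum_n (a n)%:R + \sum_g queue_kernel f a g * h g = phi + h f).
Proof.
have [phi [h [opt greedy]]] := average_optimality_equation M lam01.
exists phi, (h \o bit_set); split=> [f a af|f a].
  rewrite -natr_sum sum_bits -next_value_bit_set => aM; apply: opt => //.
  by apply/fintype.subsetP => n; rewrite !inE; exact: af.
rewrite -natr_sum sum_bits -next_value_bit_set => act; apply: greedy.
- apply/fintype.subsetP => n; rewrite !inE.
  by move: act; rewrite /max_lambda_action; case: ifP => [_ ->|_ [_ + _]] //; exact.
- move: act; rewrite /max_lambda_action; case: ifP => [fM ->|_ [-> _ _]] //.
  exact: ltnW.
- move: act; rewrite /max_lambda_action; case: ifP => [_ -> //|_ [aM _ _]].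
  by rewrite /bit_set aM ltnn.
move=> i j; rewrite !inE => ai fj aj.
move: act; rewrite /max_lambda_action; case: ifP => [_ fa|_ [_ _]]; last exact.
by rewrite fa fj in aj.
Qed.

End QueueKernel.

(** * A law of large numbers for controlled finite chains *)
Section FiniteValued.
Context {d : measure_display} {Omega : measurableType d} {R : realType}.
Context (P : probability Omega R).
Implicit Types (E G : set Omega).

Lemma pr_ge0 E : 0 <= pr P E.
Proof. exact: fine_ge0. Qed.

Lemma pr0 : pr P set0 = 0.
Proof. by rewrite /pr measure0. Qed.

Lemma prT : pr P setT = 1.
Proof. by rewrite /pr probability_setT. Qed.

Lemma EFin_pr E : measurable E -> (pr P E)%:E = P E.
Proof. by move=> mE; rewrite fineK // fin_num_measure. Qed.

Lemma le_pr E G : measurable E -> measurable G -> E `<=` G -> pr P E <= pr P G.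
Proof.
move=> mE mG EG; rewrite -lee_fin !EFin_pr //.
by apply: le_measure; rewrite ?inE.
Qed.

Lemma measurable_finite_valued (Q : finType) (X : Omega -> Q) (D : Q -> Prop) :
  (forall q, measurable [set w | X w = q]) -> measurable [set w | D (X w)].
Proof.
move=> mX; have -> : [set w | D (X w)] = \bigcup_(q in D) [set w | X w = q].
  apply/seteqP; split=> w /=; first by move=> Dw; exists (X w).
  by case=> q Dq ->.
apply: fin_bigcup_measurable => // q _; exact: mX.
Qed.

Lemma pr_partition (Q : finType) (X : Omega -> Q) E : measurable E ->
  (forall q, measurable [set w | X w = q]) ->
  pr P E = \sum_q pr P (E `&` [set w | X w = q]).
Proof.
move=> mE mX; apply: EFin_inj.
rewrite EFin_pr // -sumEFin.
transitivity (\sum_q P (E `&` [set w | X w = q]))%E; last first.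
  by apply: eq_bigr => q _; rewrite EFin_pr //; exact: measurableI.
have EU : E = \bigcup_(q in [set` enum Q]) (E `&` [set w | X w = q]).
  apply/seteqP; split=> w /=; last by case=> q _ [].
  by move=> Ew; exists (X w) => //=; rewrite mem_enum.
rewrite {1}EU measure_fin_bigcup //.
- by rewrite -fsbig_seq ?enum_uniq //= big_enum.
- by move=> p q _ _ [w [[_ /= <-] [_ /= <-]]].
- by move=> q _; exact: measurableI.
Qed.

End FiniteValued.

Section Filtration.
Context {d : measure_display} {Omega : measurableType d}.
Context {H : nat -> set (set Omega)}.
Hypothesis filH : filtration H.

Lemma filtrationT t : H t setT.
Proof.
have [sH _ _] := filH; have [H0 HC _] := sH t.
by rewrite -(setD0 setT); exact: HC.
Qed.

Lemma filtrationI t E G : H t E -> H t G -> H t (E `&` G).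
Proof.
move=> HE HG; have [sH _ _] := filH; have [H0 HC HU] := sH t.
have -> : E `&` G = setT `\` ((setT `\` E) `|` (setT `\` G)).
  by rewrite !setTD -setCI setCK.
apply: (HC); rewrite -bigcup2E; apply: HU => -[|[|n]] //=; exact: HC.
Qed.

Lemma filtration_measurable t E : H t E -> measurable E.
Proof. by have [_ mH _] := filH; exact: mH. Qed.

Lemma filtrationS t E : H t E -> H t.+1 E.
Proof. by have [_ _ incH] := filH; exact: incH. Qed.

End Filtration.

(** From [1 - x <= expR (- x)] follows [expR x <= (1 - x)^-1], and [(1 + x + 2 * x ^+ 2) * (1 - x) =
    1 + x ^+ 2 * (1 - 2 * x)]. *)
Lemma expR_le_quad (R : realType) (x : R) : x <= 1 / 2 ->
  expR x <= 1 + x + 2 * x ^+ 2.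
Proof.
move=> x_le; have x_lt : 0 < 1 - x by lra.
have ex : expR x <= (1 - x)^-1.
  by rewrite -[x in leLHS]opprK expRN lef_pV2 ?posrE ?expR_gt0 // expR_ge1Dx.
apply: (le_trans ex); rewrite -[leLHS]mul1r ler_pdivrMr //; nra.
Qed.

(** * Exponential moments and almost sure bounds under nonpositive drift *)

Section ExponentialMoment.
Context {d : measure_display} {Omega : measurableType d} {R : realType}.
Context {P : probability Omega R} {H : nat -> set (set Omega)}.
Context {S T : finType} {Y : nat -> Omega -> S} {Z : nat -> Omega -> T}.
Context {q : S -> T -> R} {y : S -> T -> R} {K : R}.
Hypothesis filH : filtration H.
Hypothesis adaptY : forall t s, H t [set w | Y t w = s].
Hypothesis adaptZ : forall t z, H t.+1 [set w | Z t w = z].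
Hypothesis kernelZ : forall t G s z, H t G ->
  pr P (G `&` [set w | Y t w = s] `&` [set w | Z t w = z]) =
  pr P (G `&` [set w | Y t w = s]) * q s z.
Hypothesis q_ge0 : forall s z, 0 <= q s z.
Hypothesis q_sum1 : forall s, \sum_z q s z = 1.
Hypothesis y_le : forall s z, `|y s z| <= K.
Hypothesis drift : forall t w, \sum_z q (Y t w) z * y (Y t w) z <= 0.

Definition cumulated (n : nat) (w : Omega) : R :=
  \sum_(0 <= t < n) y (Y t w) (Z t w).

(** In the quadratic bound for the exponential, the linear term has nonpositive mean by [drift]. *)
Lemma exp_moment_step (theta : R) t w : 0 <= theta -> theta * K <= 1 / 2 ->
  \sum_z q (Y t w) z * expR (theta * y (Y t w) z) <=
  1 + 2 * (theta * K) ^+ 2.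
Proof.
move=> th0 thK; set s := Y t w.
have -> : 1 + 2 * (theta * K) ^+ 2 = \sum_z q s z * (1 + 2 * (theta * K) ^+ 2).
  by rewrite -mulr_suml q_sum1 mul1r.
apply: (@le_trans _ _ (\sum_z q s z * (1 + 2 * (theta * K) ^+ 2) +
    theta * \sum_z q s z * y s z)); last first.
  by rewrite gerDl mulr_ge0_le0 //; exact: drift.
rewrite mulr_sumr -big_split /=; apply: ler_sum => z _.
have yK := y_le s z.
have ty : `|theta * y s z| <= theta * K by rewrite normrM ger0_norm // ler_wpM2l.
have ty2 : (theta * y s z) ^+ 2 <= (theta * K) ^+ 2.
  by rewrite -[leLHS]real_normK ?num_real // lerXn2r ?nnegrE ?(le_trans _ ty).
have := @expR_le_quad R (theta * y s z) (le_trans (le_trans (ler_norm _) ty) thK).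
move=> le; rewrite [theta * (_ * _)]mulrCA -mulrDr; apply: ler_wpM2l => //; lra.
Qed.

(** The history before slot [n] takes finitely many values: [X] records it and [c] reads
    [cumulated n] off it, so the moment is a finite sum instead of an integral. As [X] is known at
    slot [n], the kernel applies conditionally on it, and each slot contributes one factor. *)
Lemma exp_moment (theta : R) n : 0 <= theta -> theta * K <= 1 / 2 ->
  exists (Q : finType) (X : Omega -> Q) (c : Q -> R),
    [/\ forall x, H n [set w | X w = x], forall w, cumulated n w = c (X w)
      & \sum_x pr P [set w | X w = x] * expR (theta * c x) <=
        (1 + 2 * (theta * K) ^+ 2) ^+ n].
Proof.
move=> th0 thK; elim: n => [|n [Q [X [c [HX cX le]]]]].
  exists unit, (fun=> tt), (fun=> 0); split=> [[]|w|].
  - by rewrite (_ : mkset _ = setT); [exact: filtrationT|apply/seteqP].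
  - by rewrite /cumulated big_geq.
  - rewrite (bigD1 tt) //= big1 => [|[]] //; rewrite addr0 mulr0 expR0 mulr1 expr0.
    by rewrite (_ : mkset _ = setT) ?prT //; apply/seteqP.
exists (Q * S * T)%type, (fun w => (X w, Y n w, Z n w)).
exists (fun x => c x.1.1 + y x.1.2 x.2).
have eqXYZ x s z : [set w | (X w, Y n w, Z n w) = (x, s, z)] =
    [set w | X w = x] `&` [set w | Y n w = s] `&` [set w | Z n w = z].
  by apply/seteqP; split=> w /= => [[-> -> ->]|[[-> ->] ->]].
split=> [[[x s] z]|w|].
- rewrite eqXYZ; apply: filtrationI => //; apply: filtrationS => //.
  exact: filtrationI.
- by rewrite /cumulated big_nat_recr //= -cX.
set k := 1 + _ in le *.
have k0 : 0 <= k by rewrite addr_ge0 // mulr_ge0 // sqr_ge0.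
pose pXY x s := pr P ([set w | X w = x] `&` [set w | Y n w = s]).
have -> : \sum_(x : Q * S * T) pr P [set w | (X w, Y n w, Z n w) = x] *
      expR (theta * (c x.1.1 + y x.1.2 x.2)) =
    \sum_x \sum_s \sum_z pr P [set w | (X w, Y n w, Z n w) = (x, s, z)] *
      expR (theta * (c x + y s z)).
  by rewrite !pair_bigA; apply: eq_bigr => -[[x s] z] _.
rewrite exprSr; apply: le_trans (ler_wpM2r k0 le); rewrite mulr_suml.
apply: ler_sum => x _.
rewrite (pr_partition P (filtration_measurable filH (HX x))
  (fun s => filtration_measurable filH (adaptY n s))) !mulr_suml.
apply: ler_sum => s _; rewrite -/(pXY x s).
(* The drift bound is available only at values that [Y n] attains, so an empty atom is treated
   apart. *)
have [E0|/set0P[w [/= Xw Yw]]] := eqVneq ([set w | X w = x] `&` [set w | Y n w = s]) set0.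
  rewrite /pXY E0 pr0 !mul0r big1 // => z _.
  by rewrite eqXYZ E0 set0I pr0 mul0r.
rewrite -mulrA.
have -> : \sum_z pr P [set w | (X w, Y n w, Z n w) = (x, s, z)] *
    expR (theta * (c x + y s z)) =
    pXY x s * (expR (theta * c x) * \sum_z q s z * expR (theta * y s z)).
  rewrite !mulr_sumr; apply: eq_bigr => z _.
  by rewrite eqXYZ kernelZ // -/(pXY x s) mulrDr expRD; ring.
rewrite ler_wpM2l ?pr_ge0 // ler_wpM2l ?expR_ge0 // -Yw.
exact: exp_moment_step.
Qed.

Definition exceeds (eps : R) n : set Omega :=
  [set w | eps * n%:R < cumulated n w].

Lemma measurable_exceeds eps n : measurable (exceeds eps n).
Proof.
(* [theta = 0] is enough here: only the finite-valued representation is wanted. *)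
have [||Q [X [c [HX cX _]]]] := @exp_moment 0 n; rewrite ?mul0r //.
rewrite /exceeds (_ : mkset _ = [set w | eps * n%:R < c (X w)]); last first.
  by apply/seteqP; split=> w /=; rewrite cX.
apply: (measurable_finite_valued (fun x => eps * n%:R < c x)) => x.
exact: (filtration_measurable filH (HX x)).
Qed.

Hypothesis K_ge1 : 1 <= K.

Lemma pr_exceeds_le (eps : R) n : 0 < eps <= 1 ->
  pr P (exceeds eps n) <= expR (- (eps ^+ 2 / (8 * K ^+ 2))) ^+ n.
Proof.
move=> /andP[e0 e1]; have K0 : 0 < K by apply: lt_le_trans K_ge1.
(* Chernoff bound: this [theta] minimises the exponent [2 * (theta * K) ^+ 2 - theta * eps], and the
   minimum is [- r]. *)
pose theta := eps / (4 * K ^+ 2); pose r := eps ^+ 2 / (8 * K ^+ 2).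
have th0 : 0 <= theta by rewrite divr_ge0 ?mulr_ge0 ?sqr_ge0 // ltW.
have thK : theta * K <= 1 / 2.
  have K2 : K <= K ^+ 2 by rewrite expr2 ler_peMr // ltW.
  have eK : eps * K <= K by rewrite ler_piMl // ltW.
  by rewrite /theta mulrAC ler_pdivrMr ?mulr_gt0 ?exprn_gt0 //; lra.
have th2 : 2 * (theta * K) ^+ 2 = r by rewrite /theta /r; field; lra.
have the : theta * eps = 2 * r by rewrite /theta /r; field; lra.
have [Q [X [c [HX cX le]]]] := exp_moment n th0 thK.
have mX x := filtration_measurable filH (HX x).
rewrite (pr_partition P (measurable_exceeds eps n) mX).
apply: (@le_trans _ _ ((\sum_x pr P [set w | X w = x] * expR (theta * c x)) *
    expR (- (theta * (eps * n%:R))))).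
  rewrite mulr_suml; apply: ler_sum => x _; rewrite -mulrA -expRD -mulrBr.
  have [cx|cx] := ltP (eps * n%:R) (c x).
    apply: (@le_trans _ _ (pr P [set w | X w = x])).
      by apply: le_pr => //; apply: measurableI => //; exact: measurable_exceeds.
    rewrite ler_peMr ?pr_ge0 // -[leLHS]expR0 ler_expR mulr_ge0 // subr_ge0.
    exact: ltW.
 rewrite (_ : _ `&` _ = set0) ?pr0 ?mulr_ge0 ?pr_ge0 ?expR_ge0 //.
  apply/seteqP; split=> w //= [+ Xw]; rewrite /exceeds /= cX Xw.
  by rewrite ltNge cx.
apply: (le_trans (ler_wpM2r (expR_ge0 _) le)).
rewrite mulrA the -mulNr expRM_natr -exprMn lerXn2r ?nnegrE ?mulr_ge0 ?expR_ge0 //.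
  by rewrite addr_ge0 // mulr_ge0 // sqr_ge0.
rewrite th2; apply: (@le_trans _ _ (expR r * expR (- (2 * r)))).
  by rewrite ler_wpM2r ?expR_ge0 // expR_ge1Dx.
by rewrite -expRD ler_expR -/r; lra.
Qed.

(** A geometric series dominates the probabilities of [exceeds eps n], so almost surely only
    finitely many of these events occur. *)
Lemma ae_cumulated_le (eps : R) : 0 < eps <= 1 ->
  {ae P, forall w, \forall n \near \oo, cumulated n w <= eps * n%:R}.
Proof.
move=> e01; have /andP[e0 _] := e01.
have K0 : 0 < K by apply: lt_le_trans K_ge1.
pose rho := expR (- (eps ^+ 2 / (8 * K ^+ 2))).
have rho0 : 0 < rho by exact: expR_gt0.
have rho1 : `|rho| < 1.
  by rewrite ger0_norm ?ltW // expR_lt1 oppr_lt0 divr_gt0 ?mulr_gt0 ?exprn_gt0.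
have sum_lt : (\sum_(n <oo) P (exceeds eps n) < +oo)%E.
  apply: (@le_lt_trans _ _ ((1 - rho)^-1)%:E); last exact: ltry.
  apply: (@le_trans _ _ (\sum_(n <oo) (geometric 1 rho n)%:E)%E).
    apply: lee_nneseries => n _ //=.
    rewrite -EFin_pr ?lee_fin; last exact: measurable_exceeds.
    by rewrite mul1r; exact: pr_exceeds_le.
  apply: lime_le => [|].
    by apply: is_cvg_nneseries => n _ _; rewrite lee_fin mulr_ge0 // exprn_ge0 // ltW.
  apply: nearW => n; rewrite sumEFin lee_fin -[leRHS]mul1r.
  exact: geometric_le_lim.
have lim0 := lim_sup_set_cvg0 (measurable_exceeds eps) sum_lt.
have mlim : measurable (lim_sup_set (exceeds eps)).
  apply: bigcap_measurable => // n _; apply: bigcup_measurable => k _.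
  exact: measurable_exceeds.
apply: (@negligibleS _ _ _ P (lim_sup_set (exceeds eps))).
  move=> w /= notle n _; apply: contrapT => notex; apply: notle.
  exists n => // k /= nk; rewrite leNgt; apply/negP => lt.
  by apply: notex; exists k.
exact/negligibleP.
Qed.

End ExponentialMoment.

(** * Throughput bounds *)
Section LiminfBounds.
Context {R : realType}.
Implicit Types (u : nat -> R) (x : R).

Lemma limn_einf_le u x :
  (forall e, 0 < e -> \forall n \near \oo, u n <= x + e) ->
  (limn_einf (EFin \o u) <= x%:E)%E.
Proof.
move=> ux; apply/lee_addgt0Pr => e e0; rewrite limn_einf_lim.
apply: lime_le; first exact: is_cvg_einfs.
have [n0 _ un0] := ux e e0; apply: nearW => n.
apply: (@le_trans _ _ (u (maxn n n0))%:E); last first.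
  by rewrite -EFinD lee_fin; apply: un0 => /=; exact: leq_maxr.
by apply: ereal_inf_lbound; exists (maxn n n0) => //=; exact: leq_maxl.
Qed.

Lemma limn_einf_ge u x :
  (forall e, 0 < e -> \forall n \near \oo, x - e <= u n) ->
  (x%:E <= limn_einf (EFin \o u))%E.
Proof.
move=> ux; apply/lee_subgt0Pr => e e0; rewrite limn_einf_lim.
apply: lime_ge; first exact: is_cvg_einfs.
have [n0 _ un0] := ux e e0; exists n0 => // n /= n0n.
apply: le_ereal_inf_tmp => _ [k /= nk <-].
by rewrite -EFinB lee_fin; apply: un0; exact: leq_trans nk.
Qed.

(** Half of [e] absorbs the slope, by the choice of [m]; the other half absorbs [C] once [n] is
    large. *)
Lemma near_mean_error (s : nat -> R) (C e : R) : 0 < e ->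
  (forall m, \forall n \near \oo, s n <= m.+1%:R^-1 * n%:R + C) ->
  \forall n \near \oo, n%:R^-1 * s n <= e.
Proof.
move=> e0 sm; have e20 : 0 < e / 2 by rewrite divr_gt0.
have [m _ me] := near_infty_natSinv_lt (PosNum e20).
have [n0 _ sn] := sm m.
near=> n; have n_gt0 : (0 < n)%N by near: n; exact: nbhs_infty_gt.
have nR : 0 < n%:R :> R by rewrite ltr0n.
rewrite ler_pdivrMl //; apply: (le_trans (sn n _)); first by near: n; exists n0.
have Cn : C <= e / 2 * n%:R.
  by rewrite -ler_pdivrMl //; near: n; exact: nbhs_infty_ger.
have : m.+1%:R^-1 * n%:R <= e / 2 * n%:R by rewrite ler_pM2r // ltW // me /=.
move=> le; rewrite (_ : n%:R * e = e / 2 * n%:R + e / 2 * n%:R); last by field.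
exact: lerD.
Unshelve. all: by end_near. Qed.

End LiminfBounds.

(** * Almost sure throughput of a controlled chain with the queue kernel *)

Section ControlledQueues.
Context {d : measure_display} {Omega : measurableType d} {R : realType}.
Context {P : probability Omega R} {N : nat} {lam : 'I_N -> R}.
Context {H : nat -> set (set Omega)} {F alpha : nat -> Omega -> bitvec N}.
Hypothesis lam01 : forall n, 0 <= lam n <= 1.
Hypothesis filH : filtration H.
Hypothesis adaptF : adapted H F.
Hypothesis adapt_alpha : adapted H alpha.
Hypothesis kernelF : forall t G f a g, H t G ->
  pr P (G `&` [set w | F t w = f] `&` [set w | alpha t w = a] `&`
        [set w | F t.+1 w = g]) =
  pr P (G `&` [set w | F t w = f] `&` [set w | alpha t w = a]) *
    queue_kernel lam f a g.

Definition served (n : nat) (w : Omega) : R :=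
  \sum_(0 <= t < n) \sum_(i < N) (alpha t w i)%:R.

(* The sign [sg] gives the upper bound for [1] and the lower bound for [-1]. *)
Lemma ae_served (sg phi : R) (h : bitvec N -> R) :
  (forall t w, sg * (\sum_i (alpha t w i)%:R +
     \sum_g queue_kernel lam (F t w) (alpha t w) g * h g -
     (phi + h (F t w))) <= 0) ->
  {ae P, forall w, forall m, \forall n \near \oo,
    sg * (served n w + h (F n w) - h (F 0%N w) - phi * n%:R) <=
    m.+1%:R^-1 * n%:R}.
Proof.
(* The tolerances [m.+1%:R^-1] are countably many, so their exceptional null sets can be united. *)
move=> drift; apply: ae_foralln => m.
pose Y t w := (F t w, alpha t w).
pose y (s : bitvec N * bitvec N) g : R :=
  sg * (\sum_i (s.2 i)%:R + h g - (phi + h s.1)).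
pose K := 1 + \big[Num.max/0]_(p : bitvec N * bitvec N * bitvec N) `|y p.1 p.2|.
have K1 : 1 <= K by rewrite lerDl bigmax_ge_id.
have yK s g : `|y s g| <= K.
  rewrite (le_trans _ (_ : \big[Num.max/0]_(p : bitvec N * bitvec N * bitvec N)
    `|y p.1 p.2| <= K)) ?lerDr //.
  exact: (le_bigmax 0 (fun p : bitvec N * bitvec N * bitvec N => `|y p.1 p.2|) (s, g)).
have YE t s : [set w | Y t w = s] =
    [set w | F t w = s.1] `&` [set w | alpha t w = s.2].
  by case: s => f a; apply/seteqP; split=> w; rewrite /Y /= => -[-> ->].
have adaptY t s : H t [set w | Y t w = s] by rewrite YE; exact: filtrationI.
have kernelY t G s g : H t G ->
    pr P (G `&` [set w | Y t w = s] `&` [set w | F t.+1 w = g]) =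
    pr P (G `&` [set w | Y t w = s]) * queue_kernel lam s.1 s.2 g.
  by move=> HG; rewrite YE setIA kernelF.
pose eps : R := m.+1%:R^-1.
have eps01 : 0 < eps <= 1.
  by apply/andP; split; rewrite ?invr_gt0 ?invf_le1 ?ltr0n ?ler1n.
(* The increments [h (F t.+1) - h (F t)] telescope to the boundary terms. *)
have servedE n w : cumulated (Z := fun t => F t.+1) (Y := Y) (y := y) n w =
    sg * (served n w + h (F n w) - h (F 0%N w) - phi * n%:R).
  rewrite /cumulated /served; elim: n => [|n IH].
    by rewrite !big_geq // mulr0 add0r subrr subr0 mulr0.
  by rewrite !big_nat_recr //= IH /y /Y /= -[n.+1%:R]natr1; ring.
have drift_y t w : \sum_g queue_kernel lam (Y t w).1 (Y t w).2 g * y (Y t w) g <= 0.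
  apply: le_trans (drift t w); rewrite le_eqVlt; apply/orP; left; apply/eqP.
  pose c := sg * (\sum_i (alpha t w i)%:R - (phi + h (F t w))).
  transitivity (\sum_g (queue_kernel lam (F t w) (alpha t w) g * c +
      sg * (queue_kernel lam (F t w) (alpha t w) g * h g))).
    by apply: eq_bigr => g _; rewrite /y /Y /c /=; ring.
  by rewrite big_split /= -mulr_suml sum_queue_kernel1 -mulr_sumr /c; ring.
have := ae_cumulated_le filH adaptY (fun t => adaptF t.+1) kernelY
  (fun s => queue_kernel_ge0 lam01 s.1 s.2)
  (fun s => sum_queue_kernel1 lam s.1 s.2) yK drift_y K1 eps01.
by apply: filterS => w; apply: filterS => n; rewrite servedE.
Qed.

(** [h] is bounded on the finite state space, so its boundary terms contribute at most [2 * C],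
    which vanishes in the mean. *)
Lemma ae_mean_served (sg phi : R) (h : bitvec N -> R) : `|sg| <= 1 ->
  (forall t w, sg * (\sum_i (alpha t w i)%:R +
     \sum_g queue_kernel lam (F t w) (alpha t w) g * h g -
     (phi + h (F t w))) <= 0) ->
  {ae P, forall w, forall e, 0 < e ->
    \forall n \near \oo, sg * (n%:R^-1 * served n w - phi) <= e}.
Proof.
move=> sg1 /ae_served; apply: filterS => w sw e e0.
pose C := \big[Num.max/0]_g `|h g|.
have hC g : `|h g| <= C by exact: (le_bigmax 0 (fun g => `|h g|)).
have err m : \forall n \near \oo,
    sg * (served n w - phi * n%:R) <= m.+1%:R^-1 * n%:R + 2 * C.
  apply: filterS (sw m) => n le_n.
  have : `|sg * (h (F n w) - h (F 0%N w))| <= 2 * C.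
    rewrite normrM; apply: (@le_trans _ _ (1 * `|h (F n w) - h (F 0%N w)|)).
      exact: ler_wpM2r.
    rewrite mul1r (le_trans (ler_normB _ _)) //.
    by have := hC (F n w); have := hC (F 0%N w); lra.
  rewrite ler_norml => /andP[lo hi].
  apply: (@le_trans _ _ (sg * (served n w + h (F n w) - h (F 0%N w) - phi * n%:R) +
    2 * C)); [nra|by rewrite lerD2r].
have := near_mean_error e0 err; apply: filterS2 (nbhs_infty_gt 0) => n n0.
have nR : n%:R != 0 :> R by rewrite pnatr_eq0 -lt0n.
suff -> : n%:R^-1 * (sg * (served n w - phi * n%:R)) =
    sg * (n%:R^-1 * served n w - phi) by [].
by field.
Qed.

Lemma ae_throughput_le (phi : R) (h : bitvec N -> R) :
  (forall t w, \sum_i (alpha t w i)%:R +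
     \sum_g queue_kernel lam (F t w) (alpha t w) g * h g <= phi + h (F t w)) ->
  {ae P, forall w, (throughput R alpha w <= phi%:E)%E}.
Proof.
move=> opt; refine (filterS _ (@ae_mean_served 1 phi h _ _)).
- move=> w mean; apply: limn_einf_le => e /mean.
  by apply: filterS => n; rewrite mul1r lerBlDl.
- by rewrite normr1.
- by move=> t w; rewrite mul1r subr_le0.
Qed.

Lemma ae_throughput_ge (phi : R) (h : bitvec N -> R) :
  (forall t w, \sum_i (alpha t w i)%:R +
     \sum_g queue_kernel lam (F t w) (alpha t w) g * h g >= phi + h (F t w)) ->
  {ae P, forall w, (phi%:E <= throughput R alpha w)%E}.
Proof.
move=> opt; refine (filterS _ (@ae_mean_served (-1) phi h _ _)).
- move=> w mean; apply: limn_einf_ge => e /mean.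
  by apply: filterS => n; rewrite mulN1r opprB lerBlDl -lerBlDr.
- by rewrite normrN1.
- by move=> t w; rewrite mulN1r oppr_le0 subr_ge0.
Qed.

End ControlledQueues.

(** * The transition kernels of the constrained problem and of the single-buffer queues *)

Section Kernels.
Context {d : measure_display} {Omega : measurableType d} {R : realType}.
Context {P : probability Omega R} {N : nat} {M : nat} {lam : 'I_N -> R}.

Lemma measurable_bit (X : Omega -> bitvec N) n (c : bool) :
  (forall x, measurable [set w | X w = x]) -> measurable [set w | X w n = c].
Proof. exact: (measurable_finite_valued (fun x : bitvec N => x n = c)). Qed.

Lemma pr_bit (X : Omega -> bitvec N) n (E : set Omega) : measurable E ->
  (forall x, measurable [set w | X w = x]) ->
  pr P E = pr P (E `&` [set w | X w n = true]) +
           pr P (E `&` [set w | X w n = false]).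
Proof.
move=> mE mX; rewrite (pr_partition P mE (X := X ^~ n)) ?big_bool // => c.
exact: measurable_bit.
Qed.

(** Given the information event, the state and the action, the arrival and departure constraints fix
    the law of each coordinate; conditional independence multiplies these laws into the product form
    of [queue_kernel]. *)
Lemma feasible_kernel (H : nat -> set (set Omega))
    (F alpha : nat -> Omega -> bitvec N) : feasible P M lam H F alpha ->
  forall t G f a g, H t G ->
    pr P (G `&` [set w | F t w = f] `&` [set w | alpha t w = a] `&`
          [set w | F t.+1 w = g]) =
    pr P (G `&` [set w | F t w = f] `&` [set w | alpha t w = a]) *
      queue_kernel lam f a g.
Proof.
case=> filH adaptF adapt_alpha _ arrival departure indep t G f a g HG.
have := indep t f a g G HG; set B := _ `&` [set w | alpha t w = a] => /= indepB.
have HB : H t B by apply: filtrationI => //; exact: filtrationI.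
have mF s x := filtration_measurable filH (adaptF s x).
have mB := filtration_measurable filH HB.
(* The conditional constraints say nothing on a null event, where both sides are 0. *)
have [B0|B_neq0] := eqVneq (pr P B) 0.
  rewrite B0 mul0r; apply/eqP; rewrite eq_le pr_ge0 andbT -B0.
  by apply: le_pr => //; exact: measurableI.
have B_gt0 : 0 < pr P B by rewrite lt_neqAle eq_sym B_neq0 pr_ge0.
have := indepB B_gt0; rewrite {1}/cond_pr setIC => /(canRL (divfK B_neq0)) ->.
rewrite mulrC queue_kernel_prod; congr (_ * _); apply: eq_bigr => n _.
have condE : cond_pr P [set w | F t.+1 w n = true] B +
    cond_pr P [set w | F t.+1 w n = false] B = 1.
  rewrite /cond_pr -mulrDl ![_ `&` B]setIC -(pr_bit n mB) ?divff //.
rewrite /bit_weight; have [fn|fn] := boolP (f n).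
  (* The constraint is applied with [B] as the information event, which already fixes the state and
     the action. *)
  have := departure t n (a n) B HB.
  have -> : B `&` [set w | F t w n = true] `&` [set w | alpha t w n = a n] = B.
    apply/seteqP; split=> [w [[]] //|w Bw]; have [[_ /= Fw] /= aw] := Bw.
    by rewrite /= Fw aw.
  move=> /= /(_ B_gt0); case: (a n); case: (g n) => /= dep; lra.
have := arrival t n B HB.
have -> : B `&` [set w | F t w n = false] = B.
  apply/seteqP; split=> [w [] //|w Bw]; have [[_ /= Fw] _] := Bw.
  by split=> //=; rewrite Fw; exact: negbTE.
by move=> /= /(_ B_gt0) arr; case: (g n) => /=; lra.
Qed.

Lemma pr_arrival_bit (A : nat -> Omega -> bitvec N) t n c :
  iid_arrivals P lam A -> pr P [set w | A t w n = c] = bit_weight lam n c.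
Proof.
case=> mA rate _; have := pr_bit n (@measurableT _ Omega) (mA t).
by rewrite prT !setTI rate; case: c; rewrite /bit_weight ?rate //; lra.
Qed.

(** Independence is stated for whole initial paths, so the law of [A t] is obtained by summing over
    all pasts [z], whose weights add up to 1. *)
Lemma pr_arrival (A : nat -> Omega -> bitvec N) t b : iid_arrivals P lam A ->
  pr P [set w | A t w = b] = \prod_n bit_weight lam n (b n).
Proof.
move=> iidA; have [mA _ indep] := iidA.
pose Z w := [ffun s : 'I_t => A s w].
have mZ z : measurable [set w | Z w = z].
  rewrite (_ : mkset _ = \bigcap_(s in [set: 'I_t]) [set w | A s w = z s]).
    by apply: fin_bigcap_measurable => // s _; exact: mA.
  apply/seteqP; split=> [w <- s _ /=|w Zw /=]; first by rewrite ffunE.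
  by apply/ffunP => s; rewrite ffunE; exact: Zw.
rewrite (pr_partition P (mA t b) mZ).
(* The default [b] supplies the value at slot [t]; later slots are never inspected. *)
pose path (z : {ffun 'I_t -> bitvec N}) s := if insub s is Some i then z i else b.
have pathE z : [set w | A t w = b] `&` [set w | Z w = z] =
    [set w | forall s, (s < t.+1)%N -> A s w = path z s].
  apply/seteqP; split=> [w /= [Ab <-] s|w /= Apath].
    rewrite ltnS /path; case: insubP => [i _ <-|]; first by rewrite ffunE.
    by rewrite -leqNgt => ts st; rewrite (_ : s = t) //; apply/eqP; rewrite eqn_leq st.
  split; first by rewrite Apath // /path insubF ?ltnn.
  by apply/ffunP => s; rewrite ffunE (Apath s (leqW (ltn_ord s))) /path valK.
transitivity (\sum_(z : {ffun 'I_t -> bitvec N})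
    (\prod_s \prod_n bit_weight lam n (z s n)) *
    \prod_n bit_weight lam n (b n)).
  apply: eq_bigr => z _; rewrite pathE indep big_nat_recr //= big_mkord.
  congr (_ * _); last first.
    by apply: eq_bigr => n _; rewrite pr_arrival_bit // /path insubF ?ltnn.
  apply: eq_bigr => s _; apply: eq_bigr => n _.
  by rewrite pr_arrival_bit // /path valK.
rewrite -mulr_suml.
rewrite -(bigA_distr_bigA (fun=> fun x : bitvec N => \prod_n bit_weight lam n (x n))).
by rewrite big1 ?mul1r // => s _; exact: sum_bit_weight.
Qed.

(** Splitting along [A t = b], the next state is determined by [f], [a] and [b], and blindness to
    the arrivals factors out the probability of [b]. *)
Lemma queue_policy_kernel (A : nat -> Omega -> bitvec N)
    (H : nat -> set (set Omega)) (F alpha : nat -> Omega -> bitvec N) :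
  iid_arrivals P lam A -> queue_policy P M A H F alpha ->
  forall t G f a g, H t G ->
    pr P (G `&` [set w | F t w = f] `&` [set w | alpha t w = a] `&`
          [set w | F t.+1 w = g]) =
    pr P (G `&` [set w | F t w = f] `&` [set w | alpha t w = a]) *
      queue_kernel lam f a g.
Proof.
move=> iidA [filH adaptF adapt_alpha _ blind dyn] t G f a g HG.
have [mA _ _] := iidA.
set B := _ `&` [set w | alpha t w = a].
have HB : H t B by apply: filtrationI => //; exact: filtrationI.
have mB := filtration_measurable filH HB.
have mF := filtration_measurable filH (adaptF t.+1 g).
rewrite (pr_partition P (measurableI _ _ mB mF) (mA t)) mulr_sumr [RHS]big_mkcond.
apply: eq_bigr => b _; rewrite -(pr_arrival t b iidA) -blind //.
have FE w : B w -> A t w = b -> F t.+1 w = next_state f a b.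
  move=> [[_ Fw] aw] Ab; apply/ffunP => n.
  by rewrite dyn ffunE Fw aw Ab; case: ifP.
case: eqP => [<-|neq].
  congr (pr P _); apply/seteqP; split=> [w [[Bw _] Ab]|w [Bw Ab]] //.
  by split=> //; split=> //; exact: FE.
rewrite (_ : _ `&` _ = set0) ?pr0 //; apply/seteqP; split=> w //= [[Bw Fg] Ab].
by apply: neq; rewrite -(FE w).
Qed.

End Kernels.

(** * The two optimality statements *)

Lemma service_le (Omega : Type) (N M : nat) (F alpha : nat -> Omega -> bitvec N) t w :
  service_constraints M F alpha -> (forall n, alpha t w n -> F t w n).
Proof.
move=> /(_ t w)[_ le] n an; have := le n.
by rewrite an !inE eq_sym => /eqP.
Qed.

Theorem theorem4p4p1 (R : realType) (N M : nat) (lam : 'I_N -> R)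
    (hM : (M < N)%N) (hlam : forall n, 0 <= lam n <= 1) :
  (exists phi : R,
     (forall (d : measure_display) (Omega : measurableType d)
        (P : probability Omega R) (H : nat -> set (set Omega))
        (F alpha : nat -> Omega -> bitvec N),
        feasible P M lam H F alpha ->
        max_lambda_policy M lam F alpha ->
        {ae P, forall w, throughput R alpha w = phi%:E}) /\
     (forall (d : measure_display) (Omega : measurableType d)
        (P : probability Omega R) (H : nat -> set (set Omega))
        (F alpha : nat -> Omega -> bitvec N),
        feasible P M lam H F alpha ->
        {ae P, forall w, (throughput R alpha w <= phi%:E)%E}))
  /\
  (forall (d : measure_display) (Omega : measurableType d)
     (P : probability Omega R) (A : nat -> Omega -> bitvec N)
     (Hmax : nat -> set (set Omega)) (Fmax alphamax : nat -> Omega -> bitvec N)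
     (H : nat -> set (set Omega)) (F alpha : nat -> Omega -> bitvec N),
     iid_arrivals P lam A ->
     queue_policy P M A Hmax Fmax alphamax ->
     max_lambda_policy M lam Fmax alphamax ->
     queue_policy P M A H F alpha ->
     {ae P, forall w, (throughput R alpha w <= throughput R alphamax w)%E}).
Proof.
(* [phi] and [h] are fixed before any probability space or policy, so one constant serves for all of
   them. *)
have [phi [h [opt greedy]]] := queue_average_optimality M hlam.
have step_le (Omega : Type) (F alpha : nat -> Omega -> bitvec N) t w :
    service_constraints M F alpha ->
    \sum_i (alpha t w i)%:R + \sum_g queue_kernel lam (F t w) (alpha t w) g * h g
      <= phi + h (F t w).
  by move=> serv; apply: opt; [exact: service_le serv|have [] := serv t w].
split.
  exists phi; split=> [d Omega P H F alpha feas maxl|d Omega P H F alpha feas];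
    have [filH adaptF adapt_alpha serv _ _ _] := feas;
    have ker := feasible_kernel feas.
    have le := ae_throughput_le hlam filH adaptF adapt_alpha ker
      (fun t w => step_le _ _ _ t w serv).
    have ge : {ae P, forall w, (phi%:E <= throughput R alpha w)%E}.
      apply: (ae_throughput_ge hlam filH adaptF adapt_alpha ker (h := h)) => t w.
      by rewrite (greedy _ _ (maxl t w)).
    by apply: filterS2 le ge => w le ge; apply/eqP; rewrite eq_le le ge.
  exact: (ae_throughput_le hlam filH adaptF adapt_alpha ker
    (fun t w => step_le _ _ _ t w serv)).
(* The two policies are compared through [phi], an upper bound for one throughput and a lower bound
   for the other, each almost surely. *)
move=> d Omega P A Hmax Fmax alphamax H F alpha iidA polmax maxl pol.
have [filH adaptF adapt_alpha serv _ _] := pol.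
have [filHm adaptFm adapt_alpham _ _ _] := polmax.
have le := ae_throughput_le hlam filH adaptF adapt_alpha
  (queue_policy_kernel iidA pol) (fun t w => step_le _ _ _ t w serv).
have ge : {ae P, forall w, (phi%:E <= throughput R alphamax w)%E}.
  apply: (ae_throughput_ge hlam filHm adaptFm adapt_alpham
    (queue_policy_kernel iidA polmax) (h := h)) => t w.
  by rewrite (greedy _ _ (maxl t w)).
by apply: filterS2 le ge => w; exact: le_trans.
Qed.
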